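(* Let $\lVert\cdot\rVert$ be a strictly convex norm on $\mathbb{R}^2$ and let $P\subset\mathbb{R}^2$ be a finite set with $\operatorname{card}(P)\geq 2$. Then the Elzinga--Hearn algorithm (as specified step by step in the context), applied to $P$, computes the center $\bar{x}$ and the radius $\bar{\lambda}$ of the minimal enclosing disk of $P$; that is, for all choices made where the algorithm says ''choose'', it terminates after finitely many steps and returns the pair $(\bar{x},\bar{\lambda})$ such that $B(\bar{x},\bar{\lambda})$ is the minimal enclosing disk of $P$.
   Context: A norm $\lVert\cdot\rVert$ on $\mathbb{R}^2$ is strictly convex if $\lVert x+y\rVert<2$ whenever $\lVert x\rVert=\lVert y\rVert=1$ and $x\neq y$. Write $B(x,\lambda)=\{y\in\mathbb{R}^2 : \lVert y-x\rVert\leq\lambda\}$ for the disk with center $x$ and radius $\lambda$. For a compact set $P\subset\mathbb{R}^2$ put $R(P)=\inf_{x\in\mathbb{R}^2}\max_{p\in P}\lVert x-p\rVert$. A minimal enclosing disk of $P$ is a disk $B(\bar{x},\bar{\lambda})$ with $\bar{\lambda}=R(P)$ and $P\subset B(\bar{x},\bar{\lambda})$. It exists, and for strictly convex norms it is unique (known). For distinct points $x,y$, $\langle x,y\rangle=\{\lambda x+(1-\lambda)y : \lambda\in\mathbb{R}\}$ is the straight line through them, and $\operatorname{bis}(x,y)=\{z\in\mathbb{R}^2 : \lVert z-x\rVert=\lVert z-y\rVert\}$ is their bisector. A triangle is a set of exactly three points of $\mathbb{R}^2$. With $\{i,j,k\}=\{1,2,3\}$, the triangle $\{p_1,p_2,p_3\}$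 is norm-acute at $p_k$ if $\left\lVert p_k-\frac{p_i+p_j}{2}\right\rVert>\frac{\lVert p_i-p_j\rVert}{2}$, norm-right at $p_k$ if equality holds instead of $>$, and norm-obtuse at $p_k$ if $<$ holds instead of $>$. A triangle is norm-obtuse if it is norm-obtuse at one vertex and norm-acute at the other two; norm-right if it is norm-right at exactly one vertex and norm-acute at the other two; norm-acute if it is norm-acute at all three vertices. In strictly convex normed planes every triangle is of exactly one of these three types, and every norm-acute triangle has exactly one circumcenter, i.e., exactly one point equidistant from its three vertices (known). Elzinga--Hearn algorithm. Input: a finite set $P\subset\mathbb{R}^2$ with $\operatorname{card}(P)\geq 2$. (1) Choose $p_1,p_2\in P$ with $p_1\neq p_2$. (2) Set $\bar{x}:=\frac{1}{2}(p_1+p_2)$ and $\bar{\lambda}:=\frac{1}{2}\lVert p_1-p_2\rVert$. If $\lVert\bar{x}-p\rVert\leq\bar{\lambda}$ for all $p\in P$, return $(\bar{x},\bar{\lambda})$ and stop. Otherwise choose $p_3\in P$ with $\lVert\bar{x}-p_3\rVert>\bar{\lambda}$. (3) If the triangle $\{p_1,p_2,p_3\}$ is norm-obtuse or norm-right, say at the vertex $p_i$, replace $\{p_1,p_2\}$ by $\{p_1,p_2,p_3\}\setminus\{p_i\}$ and go to (2). Otherwise (the triangle is norm-acute) let $\bar{x}$ be the unique point of $\operatorname{bis}(p_1,p_2)\cap\operatorname{bis}(p_2,p_3)$ and set $\bar{\lambda}:=\lVert\bar{x}-p_1\rVert$. (4) If $\lVert\bar{x}-p\rVert\leq\bar{\lambda}$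 for all $p\in P$, return $(\bar{x},\bar{\lambda})$ and stop. Otherwise choose $p_4\in P$ with $\lVert\bar{x}-p_4\rVert>\bar{\lambda}$, and choose $p_5\in\{p_1,p_2,p_3\}$ with $\lVert p_4-p_5\rVert=\max_{i=1,2,3}\lVert p_4-p_i\rVert$. (5) If $p_4\notin\langle p_5,\bar{x}\rangle$, let $p_6$ be the point of $\{p_1,p_2,p_3\}\setminus\{p_5\}$ lying in the half plane bounded by $\langle p_5,\bar{x}\rangle$ opposite to $p_4$. If $p_4\in\langle p_5,\bar{x}\rangle$, choose $p_6\in\{p_1,p_2,p_3\}\setminus\{p_5\}$ arbitrarily. (6) Replace $\{p_1,p_2,p_3\}$ by $\{p_4,p_5,p_6\}$ and go to (3). *)

(* Defs.v *)
From mathcomp Require Import all_boot all_order all_algebra.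
From mathcomp Require Import finmap.
From mathcomp Require Import all_classical reals.
From Stdlib Require Export Relation_Operators.

Set Implicit Arguments.
Unset Strict Implicit.
Unset Printing Implicit Defensive.

Import Order.TTheory GRing.Theory Num.Theory.

Local Open Scope classical_set_scope.
Local Open Scope ring_scope.

(* The norm is an explicit function [N] rather than a normedModType instance:
   ['rV[R]_2] already carries the sup norm canonically. *)
Record is_norm (R : realType) (N : 'rV[R]_2 -> R) : Prop := IsNorm {
  norm_eq0 : forall x, N x = 0 -> x = 0;
  norm_scale : forall (a : R) x, N (a *: x) = `|a| * N x;
  norm_triangle : forall x y, N (x + y) <= N x + N y
}.

Definition strictly_convex (R : realType) (N : 'rV[R]_2 -> R) : Prop :=
  forall x y, N x = 1 -> N y = 1 -> x <> y -> N (x + y) < 2.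

Section Geometry.
Variables (R : realType) (N : 'rV[R]_2 -> R).
Implicit Types (x y z p a b c : 'rV[R]_2) (P T : {fset 'rV[R]_2}).

Definition disk x (lam : R) : set 'rV[R]_2 := [set y | N (y - x) <= lam].

(* Distances are nonnegative, so the default value 0 of the iterated maximum
   is harmless for nonempty [P]. *)
Definition max_dist x P : R := \big[Num.max/0]_(p <- P) N (x - p).

Definition enclosing_radius P : R := inf [set max_dist x P | x in setT].

Definition is_minimal_enclosing_disk P x (lam : R) : Prop :=
  lam = enclosing_radius P /\ [set` P] `<=` disk x lam.

Definition line x y : set 'rV[R]_2 :=
  [set z | exists t : R, z = t *: x + (1 - t) *: y].

Definition bis x y : set 'rV[R]_2 := [set z | N (z - x) = N (z - y)].

(* The determinant with rows [y - x] and [z - x]: it vanishes on [line x y] and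
   its sign tells on which side of that line [z] lies. *)
Definition side x y z : R :=
  (y - x) 0 0 * (z - x) 0 1 - (y - x) 0 1 * (z - x) 0 0.

(* For [p] off [line x y]: the closed half plane bounded by that line which
   does not contain [p]. *)
Definition opposite_half_plane x y p : set 'rV[R]_2 :=
  [set z | side x y p * side x y z <= 0].

Definition acute_at c a b : Prop := N (c - 2^-1 *: (a + b)) > N (a - b) / 2.
Definition right_at c a b : Prop := N (c - 2^-1 *: (a + b)) = N (a - b) / 2.
Definition obtuse_at c a b : Prop := N (c - 2^-1 *: (a + b)) < N (a - b) / 2.

Definition triangle_on T a b c : Prop :=
  #|` T| = 3%N /\ T = [fset a; b; c]%fset.

(* [T] is a norm-obtuse triangle, the obtuse vertex being [c]. *)
Definition norm_obtuse T c : Prop :=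
  exists a b, [/\ triangle_on T a b c,
    obtuse_at c a b, acute_at a b c & acute_at b c a].

(* [T] is a norm-right triangle, the right vertex being [c]. *)
Definition norm_right T c : Prop :=
  exists a b, [/\ triangle_on T a b c,
    right_at c a b, acute_at a b c & acute_at b c a].

Definition norm_acute T : Prop :=
  exists a b c, [/\ triangle_on T a b c,
    acute_at c a b, acute_at a b c & acute_at b c a].

End Geometry.

(* [AtStep i] is the situation in which step (i) of the algorithm is about to
   be executed; the arguments are the variables still in use. *)
Inductive eh_state (R : realType) : Type :=
| AtStep1
| AtStep2 (p1 p2 : 'rV[R]_2)
| AtStep3 (p1 p2 p3 : 'rV[R]_2)
| AtStep4 (p1 p2 p3 : 'rV[R]_2) (x : 'rV[R]_2) (lam : R)
| AtStep5 (p1 p2 p3 : 'rV[R]_2) (x : 'rV[R]_2) (p4 p5 : 'rV[R]_2)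
| AtStep6 (p4 p5 p6 : 'rV[R]_2)
| Returned (x : 'rV[R]_2) (lam : R).

Arguments AtStep1 {R}.

(* One transition per admissible choice in a step. "The point such that" is
   rendered by requiring the set of such points to be a singleton, so that
   the algorithm is stuck if the point fails to exist or to be unique.
   Replacing a pair or a triple by a set leaves the numbering of its elements
   free. *)
Inductive eh_step (R : realType) (N : 'rV[R]_2 -> R) (P : {fset 'rV[R]_2}) :
  eh_state R -> eh_state R -> Prop :=
| eh_choose_pair p1 p2 :
    p1 \in P -> p2 \in P -> p1 != p2 ->
    eh_step N P AtStep1 (AtStep2 p1 p2)
| eh_return_pair p1 p2 (x := 2^-1 *: (p1 + p2)) (lam := 2^-1 * N (p1 - p2)) :
    (forall p, p \in P -> N (x - p) <= lam) ->
    eh_step N P (AtStep2 p1 p2) (Returned x lam)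
| eh_choose_third p1 p2 p3
    (x := 2^-1 *: (p1 + p2)) (lam := 2^-1 * N (p1 - p2)) :
    p3 \in P -> lam < N (x - p3) ->
    eh_step N P (AtStep2 p1 p2) (AtStep3 p1 p2 p3)
| eh_drop_vertex p1 p2 p3 v q1 q2 (T := [fset p1; p2; p3]%fset) :
    norm_obtuse N T v \/ norm_right N T v ->
    [fset q1; q2]%fset = (T `\ v)%fset ->
    eh_step N P (AtStep3 p1 p2 p3) (AtStep2 q1 q2)
| eh_circumcenter p1 p2 p3 x (T := [fset p1; p2; p3]%fset) :
    (forall v, ~ (norm_obtuse N T v \/ norm_right N T v)) ->
    norm_acute N T ->
    bis N p1 p2 `&` bis N p2 p3 = [set x] ->
    eh_step N P (AtStep3 p1 p2 p3) (AtStep4 p1 p2 p3 x (N (x - p1)))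
| eh_return_triple p1 p2 p3 x lam :
    (forall p, p \in P -> N (x - p) <= lam) ->
    eh_step N P (AtStep4 p1 p2 p3 x lam) (Returned x lam)
| eh_choose_fourth p1 p2 p3 x lam p4 p5 (T := [fset p1; p2; p3]%fset) :
    p4 \in P -> lam < N (x - p4) ->
    p5 \in T -> N (p4 - p5) = max_dist N p4 T ->
    eh_step N P (AtStep4 p1 p2 p3 x lam) (AtStep5 p1 p2 p3 x p4 p5)
| eh_opposite_vertex p1 p2 p3 x p4 p5 p6 (T := [fset p1; p2; p3]%fset) :
    ~ line p5 x p4 ->
    [set` (T `\ p5)%fset] `&` opposite_half_plane p5 x p4 = [set p6] ->
    eh_step N P (AtStep5 p1 p2 p3 x p4 p5) (AtStep6 p4 p5 p6)
| eh_any_vertex p1 p2 p3 x p4 p5 p6 (T := [fset p1; p2; p3]%fset) :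
    line p5 x p4 ->
    p6 \in (T `\ p5)%fset ->
    eh_step N P (AtStep5 p1 p2 p3 x p4 p5) (AtStep6 p4 p5 p6)
| eh_new_triple p4 p5 p6 q1 q2 q3 :
    [fset q1; q2; q3]%fset = [fset p4; p5; p6]%fset ->
    eh_step N P (AtStep6 p4 p5 p6) (AtStep3 q1 q2 q3).

Definition eh_reachable (R : realType) (N : 'rV[R]_2 -> R)
    (P : {fset 'rV[R]_2}) (s : eh_state R) : Prop :=
  clos_refl_trans (eh_state R) (eh_step N P) AtStep1 s.

(* Main.v *)
Require Import Defs.
From mathcomp Require Import all_boot all_order all_algebra.
From mathcomp Require Import finmap.
From mathcomp Require Import all_classical reals.
From mathcomp Require Import ring lra zify.
From mathcomp Require Import topology normedtype derive.

(** The algorithm visits subsets of [P] with two or three points, and the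
    proof follows the radius of the minimal enclosing disk of the current
    subset. This radius never decreases, and it grows strictly whenever an
    outside point is brought in ([radius_lt_third], [exchange_radius_lt]);
    since [P] has finitely many subsets, every run stops. A run can only stop
    by returning ([eh_progress]), and then the returned disk is the minimal
    disk of the current subset and contains all of [P], so it is minimal for
    [P] too ([minimal_disk_superset]).

    The geometry rests on two comparisons for vectors [u], [v] seen from a
    candidate center placed at the origin. If [u] and [v] have the same norm,
    then a point of the cone spanned by [u] and [- v] is nearer to [u]
    than to [v] ([closer_in_cone]). If the center moves to [y] with [- y] in
    the cone spanned by [u] and [v], then the sum of the distances to [u] and
    [v] cannot decrease, and this forces [y = 0] when neither distance exceeds
    a lower bound of the two old norms ([no_better_center_in_opposite_cone]).
    When the origin is interior to the triangle [u1], [u2], [u3], the cones of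
    either kind cover the plane ([cone_cover]). Hence the circumcenter of a
    triangle that has it in its interior is the only circumcenter
    ([circumcenter_unique]) and the center of the minimal enclosing disk
    ([minimal_disk_circumcenter]).

    A norm-acute triangle has a circumcenter in its interior
    ([acute_surrounding_circumcenter]): over the triangle itself, which is
    compact, minimize the largest distance to a vertex. If some vertex were
    strictly nearer than that, moving towards the midpoint of the opposite
    edge would improve the maximum, unless the minimizer is that midpoint, and
    this is excluded by acuteness.

    In the exchange step, with the circumcenter [x] as origin, [p4] is
    [a p5 + b p6] with [b <= 0], because [p4] and [p6] are on opposite sides
    of the line through [p5] and [x]. If [a >= 0], then [p4] is nearer to [p5]
    than to [p6] by [closer_in_cone], against the choice of [p5] as the
    farthest vertex. So [a < 0]: the new triangle again surrounds [x], its
    vertices are at distance at least the old radius, and one of them is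
    farther, so no disk of the old radius contains it. *)
Set Implicit Arguments.
Unset Strict Implicit.
Unset Printing Implicit Defensive.

Import Order.TTheory GRing.Theory Num.Theory numFieldNormedType.Exports.

Section ElzingaHearn.
Local Open Scope classical_set_scope.
Local Open Scope ring_scope.

(** * Triangle inequalities for a strictly convex norm *)

Ltac vring := apply/rowP => ?; rewrite !mxE; ring.
Ltac vfield := apply/rowP => ?; rewrite !mxE; field.

Variables (R : realType) (N : 'rV[R]_2 -> R).

Hypothesis hN : is_norm N.
Implicit Types (u v w x y z p q r : 'rV[R]_2).

Lemma normZ (a : R) x : N (a *: x) = `|a| * N x.
Proof. exact: norm_scale hN a x. Qed.

Lemma normZ_ge0 (a : R) x : 0 <= a -> N (a *: x) = a * N x.
Proof. by move=> a0; rewrite normZ ger0_norm. Qed.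

Lemma norm0 : N 0 = 0.
Proof. by rewrite -(scale0r 0) normZ normr0 mul0r. Qed.

Lemma normN x : N (- x) = N x.
Proof. by rewrite -scaleN1r normZ normrN1 mul1r. Qed.

Lemma norm_subC x y : N (x - y) = N (y - x).
Proof. by rewrite -normN opprB. Qed.

Lemma normD x y : N (x + y) <= N x + N y.
Proof. exact: norm_triangle hN x y. Qed.

Lemma norm_ge0 x : 0 <= N x.
Proof. by have := normD x (- x); rewrite subrr norm0 normN; lra. Qed.

Lemma norm_eq0_inv x : N x = 0 -> x = 0.
Proof. exact: norm_eq0 hN x. Qed.

Lemma norm_gt0 x : x <> 0 -> 0 < N x.
Proof.
move=> x0; rewrite lt_neqAle norm_ge0 andbT eq_sym.
by apply/negP => /eqP /norm_eq0_inv.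
Qed.

Lemma distinct_norm_gt0 u v : N u = N v -> u <> v -> 0 < N u.
Proof.
move=> eqN neq; apply: norm_gt0 => u0; apply: neq; rewrite u0.
by rewrite (@norm_eq0_inv v) // -eqN u0 norm0.
Qed.

Lemma norm_dist_triangle z x y : N (x - y) <= N (x - z) + N (z - y).
Proof. by rewrite (_ : x - y = (x - z) + (z - y)) ?normD //; vring. Qed.

Lemma scale_eq0 (a : R) x : a *: x = 0 -> a != 0 -> x = 0.
Proof. by move=> /eqP; rewrite scaler_eq0 => /orP[->|/eqP]. Qed.

Hypothesis hsc : strictly_convex N.

(** Equality in the triangle inequality forces equal directions. Splitting the
    longer vector reduces this to the midpoint of two unit vectors. *)
Lemma strict_triangle x y : N (x + y) = N x + N y -> N y *: x = N x *: y.
Proof.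
wlog le_xy : x y / N x <= N y.
  move=> W; have [|/ltW] := leP (N x) (N y); first exact: W.
  by move=> le_yx; rewrite addrC [RHS]addrC => /(W _ _ le_yx).
have [->|/eqP x0] := eqVneq x 0; first by rewrite norm0 scaler0 scale0r.
have [->|/eqP y0] := eqVneq y 0; first by rewrite norm0 scaler0 scale0r.
have Nx := norm_gt0 x0; have Ny := norm_gt0 y0.
move=> eqN; pose a : 'rV[R]_2 := (N x)^-1 *: x.
pose b : 'rV[R]_2 := (N y)^-1 *: y.
have Na : N a = 1 by rewrite normZ_ge0 ?invr_ge0 ?norm_ge0 // mulVf ?gt_eqF.
have Nb : N b = 1 by rewrite normZ_ge0 ?invr_ge0 ?norm_ge0 // mulVf ?gt_eqF.
have xa : x = N x *: a by rewrite scalerA mulfV ?scale1r ?gt_eqF.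
have yb : y = N y *: b by rewrite scalerA mulfV ?scale1r ?gt_eqF.
clearbody a b; have [ab|/eqP neq_ab] := eqVneq a b.
  by rewrite [in LHS]xa ab [in RHS]yb !scalerA mulrC.
have lt2 := hsc Na Nb neq_ab.
have : N (x + y) <= N x * N (a + b) + (N y - N x).
  have -> : x + y = N x *: (a + b) + (N y - N x) *: b.
    by rewrite {1}xa {1}yb; vring.
  apply: le_trans (normD _ _) _.
  by rewrite !normZ_ge0 ?Nb ?subr_ge0 ?norm_ge0 // mulr1.
have : N x * N (a + b) < N x * 2 by rewrite ltr_pM2l.
by move=> ? ?; exfalso; lra.
Qed.

Lemma reverse_strict_triangle (a c : R) u v :
  N u = N v -> u <> v -> 0 < a -> 0 < c ->
  `|c - a| * N u < N (a *: u - c *: v).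
Proof.
wlog le_ac : a c u v / a <= c.
  move=> W eqN neq a0 c0; have [|/ltW] := leP a c; first by move/W; apply.
  by rewrite distrC eqN norm_subC => /W; apply=> // /esym.
move=> eqN neq a0 c0; rewrite ger0_norm ?subr_ge0 // ltNge.
apply/negP => le_w; set w := a *: u - c *: v in le_w.
have cv : c *: v = - w + a *: u by rewrite /w; vring.
have Nau : N (a *: u) = a * N u by rewrite normZ_ge0 // ltW.
have Ncv : N (c *: v) = c * N u by rewrite normZ_ge0 ?eqN // ltW.
have le_cv := normD (- w) (a *: u).
rewrite -cv normN Nau Ncv in le_cv.
have Nw : N w = (c - a) * N u by lra.
have Nu := distinct_norm_gt0 eqN neq.
have : N (- w) *: (a *: u) = N (a *: u) *: (- w).
  by apply/esym/strict_triangle; rewrite -cv Ncv Nau normN Nw; ring.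
rewrite normN Nw Nau => E; apply: neq.
have {}E : (a * N u * c) *: (u - v) = 0.
  rewrite (_ : _ *: (u - v) =
     ((c - a) * N u) *: (a *: u) - (a * N u) *: (- w)); last first.
    by rewrite /w; vring.
  by rewrite E subrr.
apply/eqP; rewrite -subr_eq0; apply/eqP; apply: scale_eq0 E _.
by rewrite !mulf_neq0 // gt_eqF.
Qed.

(** Let [c = b + 1] and move from [a u - c v] in the direction [v - u]; after
    one unit of time this reaches [(a - 1) u - b v]. The norm is convex along
    this line, and at the time [min a c], where the moving point meets one of
    the lines [R u], [R v], its norm [|c - a| * N u] is smaller than at time 0.
    If that happens not before time 1, convexity compares times 0 and 1;
    otherwise [a < 1], and the triangle inequality bounds the norm at time 1
    by [|c - a| * N u] directly. *)
Lemma closer_in_cone (a b : R) u v :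
  N u = N v -> u <> v -> 0 <= a -> 0 <= b -> 0 < a + b ->
  N (a *: u - b *: v - u) < N (a *: u - b *: v - v).
Proof.
move=> eqN neq a0 b0 ab0; pose c := b + 1.
have Eu : a *: u - b *: v - u = (a - 1) *: u - b *: v by vring.
have Ev : a *: u - b *: v - v = a *: u - c *: v by rewrite /c; vring.
have c0 : 0 < c by rewrite /c; lra.
rewrite {}Eu {}Ev.
have Nsum (s t : R) : N (s *: u + t *: v) <= (`|s| + `|t|) * N u.
  by apply: le_trans (normD _ _) _; rewrite !normZ -eqN mulrDl.
have Nu := distinct_norm_gt0 eqN neq.
(* At a = 0 the triangle inequality only gives a weak bound, so its equality
   case has to be excluded. *)
have [a00|an0] := eqVneq a 0.
  have b1 : 0 < b by lra.
  rewrite a00 scale0r !sub0r scaleN1r normN normZ_ge0 ?ltW // -eqN lt_neqAle.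
  apply/andP; split; last first.
    rewrite -scaleN1r -scaleNr; apply: le_trans (Nsum _ _) _.
    by rewrite !normrN normr1 (ger0_norm b0) /c addrC.
  apply/negP => /eqP E; apply: neq.
  have E2 : N (- (b *: v)) *: (- u) = N (- u) *: (- (b *: v)).
    apply: strict_triangle.
    by rewrite E !normN normZ_ge0 // -eqN /c; ring.
  rewrite !normN normZ_ge0 // -eqN in E2.
  apply/eqP; rewrite -subr_eq0; apply/eqP.
  have : (b * N u) *: (u - v) = 0.
    rewrite (_ : _ *: (u - v) = N u *: (- (b *: v)) - (b * N u) *: (- u)).
      by rewrite E2 subrr.
    by vring.
  by move/scale_eq0; apply; rewrite mulf_neq0 ?gt_eqF.
have {an0}a1 : 0 < a by rewrite lt_neqAle eq_sym an0.
have rev := reverse_strict_triangle eqN neq a1 c0.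
set F := N (a *: u - c *: v) in rev *.
have [lt_a1|ge_a1] := ltP a 1.
  apply: le_lt_trans rev.
  rewrite -scaleNr; apply: le_trans (Nsum _ _) _.
  apply: ler_wpM2r; first exact: norm_ge0.
  rewrite normrN (ger0_norm b0) ler0_norm ?ger0_norm /c; lra.
have [le_ac|lt_ca] := leP a c.
  rewrite -(ltr_pM2l a1) -normZ_ge0 //.
  have -> : a *: ((a - 1) *: u - b *: v)
    = (a - 1) *: (a *: u - c *: v) + (a - c) *: v by rewrite /c; vring.
  apply: le_lt_trans (normD _ _) _.
  rewrite !normZ -eqN -/F ger0_norm ?subr_ge0 // distrC.
  by rewrite [ltRHS](_ : _ = (a - 1) * F + F) ?ltrD2l //; ring.
rewrite -(ltr_pM2l c0) -normZ_ge0 ?(ltW c0) //.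
have -> : c *: ((a - 1) *: u - b *: v)
  = (c - 1) *: (a *: u - c *: v) + (a - c) *: u by rewrite /c; vring.
apply: le_lt_trans (normD _ _) _.
rewrite !normZ -/F ger0_norm; last by rewrite /c; lra.
rewrite distrC.
by rewrite [ltRHS](_ : _ = (c - 1) * F + F) ?ltrD2l //; ring.
Qed.

(** Write [(1 + a) u = (u - y) - b v] and [(1 + b) v = (v - y) - a u]. Adding
    the two triangle inequalities gives [N u + N v <= N (u - y) + N (v - y)],
    so under the bounds by [lam] everything is an equality, whence [a = b] and
    [u = - v] unless [y = 0]. *)
Lemma no_better_center_in_opposite_cone (a b lam : R) u v y :
  u <> - v -> 0 <= a -> 0 <= b -> 0 < lam ->
  lam <= N u -> lam <= N v -> N (u - y) <= lam -> N (v - y) <= lam ->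
  y = - (a *: u + b *: v) -> y = 0.
Proof.
move=> neq a0 b0 lam0 Nu Nv Nuy Nvy Ey.
have Eu : (1 + a) *: u = (u - y) + b *: (- v) by rewrite Ey; vring.
have Ev : (1 + b) *: v = (v - y) + a *: (- u) by rewrite Ey; vring.
have Hu : (1 + a) * N u <= N (u - y) + b * N v.
  rewrite -normZ_ge0 ?addr_ge0 // Eu (le_trans (normD _ _)) //.
  by rewrite normZ_ge0 // normN.
have Hv : (1 + b) * N v <= N (v - y) + a * N u.
  rewrite -normZ_ge0 ?addr_ge0 // Ev (le_trans (normD _ _)) //.
  by rewrite normZ_ge0 // normN.
have {}Nu : N u = lam by lra.
have {}Nv : N v = lam by lra.
rewrite Nu Nv in Hu Hv.
have ab : a = b.
  apply/eqP; rewrite eq_le -(ler_pM2r lam0) -(ler_pM2r lam0 b).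
  by apply/andP; split; lra.
subst b; have {}Nuy : N (u - y) = lam by lra.
have [a00|an0] := eqVneq a 0; first by rewrite Ey a00 !scale0r addr0 oppr0.
have E : N (a *: (- v)) *: (u - y) = N (u - y) *: (a *: (- v)).
  apply: strict_triangle; rewrite -Eu normZ_ge0 ?addr_ge0 //.
  by rewrite Nu Nuy normZ_ge0 // normN Nv; ring.
rewrite normZ_ge0 // normN Nv Nuy in E.
exfalso; apply: neq; apply/eqP; rewrite -addr_eq0; apply/eqP.
have : (a * lam * (1 + a)) *: (u + v) = 0.
  rewrite (_ : _ *: (u + v) =
     (a * lam) *: (u - y) - lam *: (a *: (- v))); first by rewrite E subrr.
  by rewrite Ey; vring.
by move/scale_eq0; apply; rewrite !mulf_neq0 // gt_eqF //; lra.
Qed.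

(** * Three vectors surrounding the origin *)

Definition det2 u v : R := u 0 0 * v 0 1 - u 0 1 * v 0 0.

(** The origin is interior to the nondegenerate triangle [u], [v], [w]. *)
Definition surrounds_origin u v w : Prop :=
  det2 u v != 0 /\ exists a b c : R,
    [/\ 0 < a, 0 < b, 0 < c & a *: u + b *: v + c *: w = 0].

Lemma det2_linear_l (a b : R) u v w :
  det2 (a *: u + b *: v) w = a * det2 u w + b * det2 v w.
Proof. by rewrite /det2 !mxE; ring. Qed.

Lemma det2_linear_r (a b : R) u v w :
  det2 w (a *: u + b *: v) = a * det2 w u + b * det2 w v.
Proof. by rewrite /det2 !mxE; ring. Qed.

Lemma det2C u v : det2 u v = - det2 v u.
Proof. by rewrite /det2; ring. Qed.

Lemma det2uu u : det2 u u = 0.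
Proof. by rewrite /det2; ring. Qed.

Lemma ord2P (P : 'I_2 -> Prop) : P 0 -> P 1 -> forall i, P i.
Proof.
move=> P0 P1 [[|[|//]] i].
  by rewrite (_ : Ordinal i = 0) //; apply: val_inj.
by rewrite (_ : Ordinal i = 1) //; apply: val_inj.
Qed.

(** Dividing by [det2 u v] gives the coordinates of [w]; in this form the
    identity is polynomial in the entries. *)
Lemma cramer u v w : det2 u v *: w = det2 w v *: u + det2 u w *: v.
Proof.
apply/rowP => i; rewrite !mxE /det2.
by move: i; apply: ord2P; ring.
Qed.

Lemma cramer_div u v w : det2 u v != 0 ->
  w = (det2 w v / det2 u v) *: u + (det2 u w / det2 u v) *: v.
Proof.
move=> d0; have := congr1 (fun x => (det2 u v)^-1 *: x) (cramer u v w).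
by rewrite !scalerDr !scalerA mulVf // scale1r ![_^-1 * _]mulrC.
Qed.

Lemma det2_neq0 u v : det2 u v != 0 -> u <> v /\ u <> - v.
Proof.
move=> d0; split=> E; move: d0; rewrite E ?det2uu ?eqxx //.
rewrite -scaleN1r -[_ *: v]addr0 -(scale0r v) det2_linear_l det2uu.
by rewrite !mulr0 addr0 eqxx.
Qed.

Lemma surrounds_origin_rot u v w :
  surrounds_origin u v w -> surrounds_origin v w u.
Proof.
move=> [d0 [a [b [c [a0 b0 c0 E]]]]]; split; last first.
  by exists b, c, a; split=> //; rewrite -E; vring.
have : c * det2 v w = a * det2 u v.
  have : det2 v (c *: w + a *: u) = det2 v (- b *: v + 0 *: v).
    by congr (det2 v _); apply/eqP; rewrite -subr_eq0 -E; apply/eqP; vring.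
  rewrite !det2_linear_r det2uu (det2C v u); lra.
move=> E2; apply/eqP => d; move: E2; rewrite d mulr0 => /esym/eqP.
by rewrite mulf_eq0 (negPf d0) gt_eqF.
Qed.

Lemma surrounds_origin_swap u v w :
  surrounds_origin u v w -> surrounds_origin v u w.
Proof.
move=> [d0 [a [b [c [a0 b0 c0 E]]]]]; split; first by rewrite det2C oppr_eq0.
by exists b, a, c; split=> //; rewrite -E; vring.
Qed.

(** The coefficients [i], [j], [k] of [y] may be shifted by a common constant.
    Shifting by the middle one leaves a difference of two vectors, shifting by
    the largest one leaves a nonpositive combination of two vectors. *)
Lemma cone_cover_sorted u v w (a b c i j k : R) :
    0 < a -> 0 < b -> 0 < c -> a *: u + b *: v + c *: w = 0 ->
    j <= k -> k <= i ->
  let y := (i * a) *: u + (j * b) *: v + (k * c) *: w in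
  (exists2 s, 0 <= s & exists2 t, 0 <= t & y = s *: u - t *: v) /\
  (exists2 s, 0 <= s & exists2 t, 0 <= t & y = - (s *: v + t *: w)).
Proof.
move=> a0 b0 c0 E jk ki y.
have Ez (z : R) : y = y - z *: (a *: u + b *: v + c *: w).
  by rewrite E scaler0 subr0.
split.
  exists ((i - k) * a); first by rewrite mulr_ge0 ?subr_ge0 // ltW.
  exists ((k - j) * b); first by rewrite mulr_ge0 ?subr_ge0 // ltW.
  by rewrite (Ez k) /y; vring.
exists ((i - j) * b); first by rewrite mulr_ge0 ?subr_ge0 ?(le_trans jk) // ltW.
exists ((i - k) * c); first by rewrite mulr_ge0 ?subr_ge0 // ltW.
by rewrite (Ez i) /y; vring.
Qed.

(** Each [y] lies in one of the six cones [cone(u, - v)], and then also in the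
    opposite of [cone(v, w)]. *)
Lemma cone_cover u1 u2 u3 y : surrounds_origin u1 u2 u3 ->
  exists u v w, [/\ surrounds_origin u v w,
    {subset [:: u; v; w] <= [:: u1; u2; u3]},
    exists2 s, 0 <= s & exists2 t, 0 <= t & y = s *: u - t *: v &
    exists2 s, 0 <= s & exists2 t, 0 <= t & y = - (s *: v + t *: w)].
Proof.
move=> sur; have [d0 [a [b [c [a0 b0 c0 E]]]]] := sur.
have [i [j [k Ey]]] : exists i j k : R,
    y = (i * a) *: u1 + (j * b) *: u2 + (k * c) *: u3.
  exists (det2 y u2 / det2 u1 u2 / a), (det2 u1 y / det2 u1 u2 / b), 0.
  rewrite mul0r scale0r addr0 !mulfVK ?gt_eqF //; exact: cramer_div.
wlog ij : u1 u2 a b i j sur {d0} a0 b0 E Ey / j <= i.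
  move=> W; have [|/ltW le_ij] := leP j i.
    exact: (W u1 u2 a b i j).
  have E' : b *: u2 + a *: u1 + c *: u3 = 0 by rewrite -E; vring.
  have Ey' : y = (j * b) *: u2 + (i * a) *: u1 + (k * c) *: u3.
    by rewrite Ey; vring.
  have [u [v [w [? sub ? ?]]]] :=
    W u2 u1 b a j i (surrounds_origin_swap sur) b0 a0 E' Ey' le_ij.
  by exists u, v, w; split=> // z /sub; rewrite !inE orbCA.
have [jk|/ltW kj] := leP j k; last first.
  have E' : a *: u1 + c *: u3 + b *: u2 = 0 by rewrite -E; vring.
  have Ey' : y = (i * a) *: u1 + (k * c) *: u3 + (j * b) *: u2.
    by rewrite Ey; vring.
  exists u1, u3, u2; split.
  - by apply/surrounds_origin_swap/surrounds_origin_rot/surrounds_origin_rot.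
  - by move=> z; rewrite !inE => /or3P[] ->; rewrite ?orbT.
  - rewrite Ey'; exact: (cone_cover_sorted a0 c0 b0 E' kj ij).1.
  - rewrite Ey'; exact: (cone_cover_sorted a0 c0 b0 E' kj ij).2.
have [ki|/ltW ik] := leP k i.
  exists u1, u2, u3; split=> //; rewrite Ey.
    exact: (cone_cover_sorted a0 b0 c0 E jk ki).1.
  exact: (cone_cover_sorted a0 b0 c0 E jk ki).2.
have E' : c *: u3 + b *: u2 + a *: u1 = 0 by rewrite -E; vring.
have Ey' : y = (k * c) *: u3 + (j * b) *: u2 + (i * a) *: u1.
  by rewrite Ey; vring.
exists u3, u2, u1; split.
- exact/surrounds_origin_swap/surrounds_origin_rot.
- by move=> z; rewrite !inE => /or3P[] ->; rewrite ?orbT.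
- rewrite Ey'; exact: (cone_cover_sorted c0 b0 a0 E' ij ik).1.
- rewrite Ey'; exact: (cone_cover_sorted c0 b0 a0 E' ij ik).2.
Qed.

(** In the cone of [u] and [- v] containing [y], a nonzero [y] is strictly
    nearer to [u] than to [v]. *)
Lemma surrounding_circumcenter_unique u1 u2 u3 y : surrounds_origin u1 u2 u3 ->
    N u1 = N u2 -> N u2 = N u3 -> N (u1 - y) = N (u2 - y) ->
    N (u2 - y) = N (u3 - y) ->
  y = 0.
Proof.
move=> sur e12 e23 d12 d23.
have [u [v [w [[/det2_neq0[neq _] _] sub [s s0 [t t0 Ey]] _]]]] :=
  cone_cover y sur.
have Eu z : z \in [:: u1; u2; u3] -> N z = N u1 /\ N (z - y) = N (u1 - y).
  by rewrite !inE => /or3P[] /eqP ->; rewrite ?e12 ?e23 ?d12 ?d23.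
have [Nu du] := Eu u (sub u (mem_head _ _)).
have vin : v \in [:: u; v; w] by rewrite !inE eqxx orbT.
have [Nv dv] := Eu v (sub v vin).
have [st0|st0] := ltP 0 (s + t).
  have := closer_in_cone (etrans Nu (esym Nv)) neq s0 t0 st0.
  by rewrite -Ey norm_subC du (norm_subC y) dv ltxx.
have [s00 t00] : s = 0 /\ t = 0 by split; lra.
by rewrite Ey s00 t00 !scale0r subr0.
Qed.

Lemma surrounded_center_optimal (lam : R) u1 u2 u3 y :
    surrounds_origin u1 u2 u3 -> 0 < lam ->
    {in [:: u1; u2; u3], forall u, lam <= N u} ->
    {in [:: u1; u2; u3], forall u, N (u - y) <= lam} ->
  y = 0.
Proof.
move=> sur lam0 out ins.
have [u [v [w [/surrounds_origin_rot[d0 _] sub _ [s s0 [t t0 Ey]]]]]] :=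
  cone_cover y sur.
have [_ neq] := det2_neq0 d0.
have vin : v \in [:: u1; u2; u3] by apply: sub; rewrite !inE eqxx orbT.
have win : w \in [:: u1; u2; u3] by apply: sub; rewrite !inE eqxx !orbT.
exact: no_better_center_in_opposite_cone neq s0 t0 lam0
  (out v vin) (out w win) (ins v vin) (ins w win) Ey.
Qed.

(** * Minimizing the largest distance over a triangle *)

Implicit Types (P T : {fset 'rV[R]_2}).

Lemma le_max_dist x P p : p \in P -> N (x - p) <= max_dist N x P.
Proof. by move=> pP; apply: (@le_bigmax_seq _ _ _ _ _ _ xpredT). Qed.

Lemma max_dist_ge0 x P : 0 <= max_dist N x P.
Proof.
rewrite /max_dist; elim/big_rec: _ => // p r _ r0.
by rewrite le_max r0 orbT.
Qed.

Lemma max_dist_le x P (m : R) : 0 <= m ->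
  (forall p, p \in P -> N (x - p) <= m) -> max_dist N x P <= m.
Proof.
move=> m0 le_m; rewrite /max_dist big_seq; elim/big_rec: _ => // p r pP r0.
by rewrite ge_max r0 le_m.
Qed.

Lemma max_dist_lt x P (m : R) : 0 < m ->
  (forall p, p \in P -> N (x - p) < m) -> max_dist N x P < m.
Proof.
move=> m0 lt_m; rewrite /max_dist big_seq; elim/big_rec: _ => // p r pP r0.
by rewrite gt_max r0 lt_m.
Qed.

Lemma max_dist_lipschitz x y P : max_dist N x P <= max_dist N y P + N (x - y).
Proof.
apply: max_dist_le => [|p pP].
  by rewrite addr_ge0 ?max_dist_ge0 ?norm_ge0.
rewrite [leRHS]addrC; apply: le_trans (norm_dist_triangle y _ _) _.
by rewrite lerD2l le_max_dist.
Qed.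

Definition in_triangle p q r x : Prop := exists a b c : R,
  [/\ 0 <= a, 0 <= b, 0 <= c, a + b + c = 1 & x = a *: p + b *: q + c *: r].

(** The triangle is the image of a compact set of parameters, on which the
    largest distance is Lipschitz continuous. *)
Lemma max_dist_triangle_min p q r P : exists2 x, in_triangle p q r x &
  forall y, in_triangle p q r y -> max_dist N x P <= max_dist N y P.
Proof.
pose g (z : R * R) := p + z.1 *: (q - p) + z.2 *: (r - p).
pose K : set (R * R) := (`[0, 1] `*` `[0, 1]) `&` [set z | z.1 + z.2 <= 1].
have KP x : in_triangle p q r x <-> exists2 z, K z & x = g z.
  split=> [[a [b [c [a0 b0 c0 abc ->]]]]|[[b c] [[/=]]]].
    exists (b, c); last by rewrite /g /= (_ : a = 1 - b - c); [vring|lra].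
    by rewrite /K /= !in_itv /=; split; [split|]; lra.
  rewrite !in_itv /= => /andP[b0 _] /andP[c0 _] bc ->.
  by exists (1 - b - c), b, c; split; [lra..|rewrite /g /=; vring].
have cg : continuous (fun z : R * R => max_dist N (g z) P).
  move=> z; pose C := N (q - p) + N (r - p) + 1.
  have C0 : 0 < C.
    by rewrite /C; have := norm_ge0 (q - p); have := norm_ge0 (r - p); lra.
  have lip (z1 z2 : R * R) : max_dist N (g z1) P - max_dist N (g z2) P
      <= C * (`|z1.1 - z2.1| + `|z1.2 - z2.2|).
    rewrite lerBlDl; apply: le_trans (max_dist_lipschitz _ (g z2) _) _.
    rewrite lerD2l.
    have -> : g z1 - g z2 = (z1.1 - z2.1) *: (q - p) + (z1.2 - z2.2) *: (r - p).
      by rewrite /g; vring.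
    apply: le_trans (normD _ _) _; rewrite !normZ /C.
    have := norm_ge0 (q - p); have := norm_ge0 (r - p).
    have := normr_ge0 (z1.1 - z2.1); have := normr_ge0 (z1.2 - z2.2).
    by move=> *; nra.
  apply/cvgrPdist_lt => e e0.
  have d0 : 0 < e / (2 * C) by rewrite divr_gt0 // mulr_gt0.
  have /cvgrPdist_lt c1 : x.1 @[x --> nbhs z] --> z.1 by exact: cvg_fst.
  have /cvgrPdist_lt c2 : x.2 @[x --> nbhs z] --> z.2 by exact: cvg_snd.
  near=> z'.
  have d1 : `|z.1 - z'.1| < e / (2 * C).
    by near: z'; exact: c1.
  have d2 : `|z.2 - z'.2| < e / (2 * C).
    by near: z'; exact: c2.
  have Ce : C * (`|z.1 - z'.1| + `|z.2 - z'.2|) < e.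
    rewrite -ltr_pdivlMl // mulrC; move: d1 d2.
    rewrite invfM mulrA -[e / 2 / C]mulrAC.
    lra.
  have := lip z z'; have := lip z' z.
  rewrite (distrC z'.1) (distrC z'.2) ltr_norml => *; apply/andP; split; lra.
have cK : compact K.
  apply: compact_closedI; first by apply: compact_setX; exact: segment_compact.
  apply: (@preimage_closed _ _ (fun z : R * R => z.1 + z.2) [set x | x <= 1]).
    by move=> z _; apply: cvgD; [exact: cvg_fst|exact: cvg_snd].
  exact: closed_le.
have K0 : K !=set0.
  by exists (0, 0); rewrite /K /= !in_itv /=; split; [split|]; lra.
have [z zK zmin] := compact_EVT_min K0 cK (continuous_subspaceT cg).
exists (g z); first by apply/KP; exists z => //; exact/set_mem.
by move=> y /KP[z' z'K ->]; apply: zmin; exact/mem_set.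
Unshelve. all: by end_near. Qed.


(** * Circumcenters of norm-acute triangles *)

Lemma acute_atC p q r : acute_at N r p q -> acute_at N r q p.
Proof. by rewrite /acute_at (addrC p q) (norm_subC p q). Qed.

Lemma acute_at_neq p q r : acute_at N p q r -> p <> q.
Proof.
rewrite /acute_at => + E; rewrite -{}E.
have -> : p - 2^-1 *: (p + r) = 2^-1 *: (p - r) by vfield.
by rewrite normZ_ge0 ?invr_ge0 // mulrC ltxx.
Qed.

Lemma between_midpoint (m : R) p q x :
  N (p - x) <= m -> N (q - x) <= m -> 2 * m <= N (p - q) ->
  x = 2^-1 *: (p + q).
Proof.
move=> Np Nq Npq; rewrite norm_subC in Nq.
have := norm_dist_triangle x p q => le_pq.
have {Np}Np : N (p - x) = m by lra.
have {Nq}Nq : N (x - q) = m by lra.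
have E : N (x - q) *: (p - x) = N (p - x) *: (x - q).
  apply: strict_triangle; have -> : p - x + (x - q) = p - q by vring.
  by lra.
have [m0|mn0] := eqVneq m 0.
  rewrite m0 in Np Nq.
  have /eqP := norm_eq0_inv Np; have /eqP := norm_eq0_inv Nq.
  by rewrite !subr_eq0 => /eqP <- /eqP ->; vfield.
rewrite Np Nq in E; have /scale_eq0/(_ mn0) E' : m *: (p + q - 2 *: x) = 0.
  by rewrite -[RHS](subrr (m *: (x - q))) -{1}E; vring.
have -> : x = 2^-1 *: (p + q) - 2^-1 *: (p + q - 2 *: x) by vfield.
by rewrite E' scaler0 subr0; vfield.
Qed.

Lemma det2_eq0_parallel u v :
  det2 u v = 0 -> v <> 0 -> exists k : R, u = k *: v.
Proof.
rewrite /det2 => d v0; have [v00|v00] := eqVneq (v 0 0) 0; last first.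
  exists (u 0 0 / v 0 0); apply/rowP; apply: ord2P; rewrite !mxE ?mulfVK //.
  apply: (mulfI v00); rewrite mulrA mulrCA divff // mulr1; lra.
have [v01|v01] := eqVneq (v 0 1) 0.
  by case: v0; apply/rowP; apply: ord2P; rewrite !mxE.
exists (u 0 1 / v 0 1); apply/rowP; apply: ord2P; rewrite !mxE ?mulfVK //.
move: d; rewrite v00 !mulr0 subr0 => /eqP.
by rewrite mulf_eq0 (negPf v01) orbF => /eqP.
Qed.

(** A circumcenter on the line of [p] and [q] would be their midpoint, and then
    the triangle would be norm-right at [r]. *)
Lemma acute_circumcenter_off_edge p q r x : acute_at N r p q -> p <> q ->
  N (p - x) = N (q - x) -> N (q - x) = N (r - x) -> det2 (p - x) (q - x) != 0.
Proof.
move=> acute neq Npq Nqr; apply/eqP => d.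
have Mgt0 : 0 < N (q - x).
  rewrite -Npq; apply: (distinct_norm_gt0 Npq) => E; apply: neq.
  by rewrite -(subrK x p) E subrK.
have [|k E] := det2_eq0_parallel d.
  by move=> E; rewrite E norm0 ltxx in Mgt0.
have k1 : `|k| = 1.
  have /eqP := Npq; rewrite E normZ -subr_eq0 -{2}[N (q - x)]mul1r -mulrBl.
  by rewrite mulf_eq0 (gt_eqF Mgt0) orbF subr_eq0 => /eqP.
have [k0|k0] := leP 0 k.
  apply: neq; rewrite -(subrK x p) E.
  by rewrite (_ : k = 1) ?scale1r ?subrK //; rewrite ger0_norm in k1.
rewrite ltr0_norm // in k1; have {}k1 : k = -1 by lra.
have Ex : x = 2^-1 *: (p + q).
  have -> : x = 2^-1 *: (p + q) - 2^-1 *: ((p - x) + (q - x)) by vfield.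
  by rewrite E k1 scaleN1r addNr scaler0 subr0; vfield.
have Epq : p - q = (- 2) *: (q - x).
  by have -> : p - q = (p - x) - (q - x) by [vring]; rewrite E k1; vring.
by move: acute; rewrite /acute_at -Ex -Nqr Epq normZ normrN ger0_norm //; lra.
Qed.

(** If [r] were strictly nearer than the maximum, the minimizer could be
    improved by a short move towards the midpoint of the opposite edge, which
    stays inside the triangle. That midpoint is itself at distance less than
    the maximum from [p] and [q], unless it is the minimizer; then [r] would be
    in the disk with diameter [p q]. *)
Lemma minimizer_touches p q r x : acute_at N r p q ->
    in_triangle p q r x ->
    (forall y, in_triangle p q r y ->
      max_dist N x [fset p; q; r]%fset <= max_dist N y [fset p; q; r]%fset) ->
  N (r - x) = max_dist N x [fset p; q; r]%fset.
Proof.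
set T := [fset p; q; r]%fset; move=> acute xin xmin.
set M := max_dist N x T in xmin *.
have le_M v : v \in T -> N (v - x) <= M by rewrite norm_subC => /le_max_dist.
have Np : N (p - x) <= M by apply: le_M; rewrite !inE eqxx.
have Nq : N (q - x) <= M by apply: le_M; rewrite !inE eqxx orbT.
have Nr : N (r - x) <= M by apply: le_M; rewrite !inE eqxx !orbT.
apply/eqP; rewrite eq_le Nr leNgt; apply/negP => lt_M.
pose m := 2^-1 *: (p + q); pose h := N (p - q) / 2.
have h_le : h <= M.
  by have := norm_dist_triangle x p q; rewrite (norm_subC x q) /h; lra.
have [E|h_neq] := eqVneq h M.
  have Ex : x = m by apply: (between_midpoint Np Nq); rewrite -E /h; lra.
  by move: acute; rewrite /acute_at -/m -Ex -/h E; lra.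
have {h_neq h_le} h_lt : h < M by rewrite lt_neqAle h_neq.
pose d := M - N (r - x); pose K := N (r - m).
have K0 : 0 <= K by exact: norm_ge0.
(* A step length in (0, 1] with e * K < d: the vertex r has the slack d, and
   its distance grows by at most e * K. *)
pose e := d / (d + K + 1).
have d0 : 0 < d by rewrite /d; lra.
have dK : 0 < d + K + 1 by lra.
have e0 : 0 < e by rewrite divr_gt0.
have e1 : e <= 1 by rewrite ler_pdivrMr // mul1r; lra.
have eK : e * K < d.
  rewrite /e mulrAC ltr_pdivrMr // ltr_pM2l //; lra.
have e2 : 0 <= e / 2 by rewrite divr_ge0 // ltW.
clearbody e; pose y := (1 - e) *: x + e *: m.
have yin : in_triangle p q r y.
  have [a [b [c [a0 b0 c0 abc Ex]]]] := xin.
  exists ((1 - e) * a + e / 2), ((1 - e) * b + e / 2), ((1 - e) * c); split.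
  - by rewrite addr_ge0 // mulr_ge0 // subr_ge0.
  - by rewrite addr_ge0 // mulr_ge0 // subr_ge0.
  - by rewrite mulr_ge0 // subr_ge0.
  - rewrite -[RHS](_ : (1 - e) * (a + b + c) + e = 1); first by field.
    by rewrite abc; ring.
  - by rewrite /y /m Ex; vfield.
have Ny v : N (v - y) <= (1 - e) * N (v - x) + e * N (v - m).
  have -> : v - y = (1 - e) *: (v - x) + e *: (v - m) by rewrite /y; vring.
  by apply: le_trans (normD _ _) _; rewrite !normZ_ge0 //; lra.
have Npm : N (p - m) = h.
  have -> : p - m = 2^-1 *: (p - q) by rewrite /m; vfield.
  by rewrite normZ_ge0 ?invr_ge0 // mulrC.
have Nqm : N (q - m) = h.
  have -> : q - m = 2^-1 *: (q - p) by rewrite /m; vfield.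
  by rewrite normZ_ge0 ?invr_ge0 // mulrC norm_subC.
have M0 : 0 < M by have := norm_ge0 (r - x); lra.
suff : max_dist N y T < M by rewrite ltNge (xmin y yin).
have slack v : N (v - x) <= M -> N (v - m) = h -> N (v - y) < M.
  move=> le_vx Nv; apply: le_lt_trans (Ny v) _; rewrite Nv.
  have : (1 - e) * N (v - x) <= (1 - e) * M by rewrite ler_wpM2l //; lra.
  have : e * h < e * M by rewrite ltr_pM2l.
  lra.
apply: max_dist_lt => // v; rewrite !inE norm_subC => /orP[/orP[]|] /eqP ->.
- exact: slack.
- exact: slack.
apply: le_lt_trans (Ny r) _.
have : (1 - e) * N (r - x) <= N (r - x).
  by rewrite ler_piMl ?norm_ge0 //; lra.
rewrite -/K /d in eK *; lra.
Qed.


Lemma fset3_rot p q r : [fset q; r; p]%fset = [fset p; q; r]%fset.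
Proof.
by apply/fsetP => z; rewrite !inE; case: (z == p); rewrite ?orbT ?orbF.
Qed.

Definition acute3 p q r : Prop :=
  [/\ acute_at N r p q, acute_at N p q r & acute_at N q r p].

Definition surrounding_circumcenter p q r x : Prop :=
  [/\ surrounds_origin (p - x) (q - x) (r - x),
      N (p - x) = N (q - x) & N (q - x) = N (r - x)].

Lemma det2_relation_trivial (a b : R) u v :
  det2 u v != 0 -> a *: u + b *: v = 0 -> a = 0 /\ b = 0.
Proof.
move=> d0 E.
have : a * det2 u v = 0.
  have := det2_linear_l a b u v v; rewrite det2uu mulr0 addr0 E => <-.
  by rewrite /det2 !mxE; ring.
have : b * det2 u v = 0.
  have := det2_linear_r a b u v u; rewrite det2uu mulr0 add0r E => <-.
  by rewrite /det2 !mxE; ring.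
move=> /eqP + /eqP; rewrite !mulf_eq0 (negPf d0) !orbF.
by move=> /eqP -> /eqP ->.
Qed.

(** The minimizer over the triangle touches all three vertices. A vanishing
    barycentric coordinate would put it on an edge. *)
Lemma acute_surrounding_circumcenter p q r :
  acute3 p q r -> exists x, surrounding_circumcenter p q r x.
Proof.
move=> [ar ap aq].
have [x xin xmin] := max_dist_triangle_min p q r [fset p; q; r]%fset.
have tr := minimizer_touches ar xin xmin.
have tp : N (p - x) = max_dist N x [fset p; q; r]%fset.
  have ET := fset3_rot p q r.
  have Et y : in_triangle q r p y -> in_triangle p q r y.
    move=> [a [b [c [a0 b0 c0 abc ->]]]]; exists c, a, b; split=> //.
      by rewrite -abc; ring.
    by vring.
  rewrite -ET; apply: (@minimizer_touches q r p) => //.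
    have [a [b [c [a0 b0 c0 abc ->]]]] := xin; exists b, c, a; split=> //.
      by rewrite -abc; ring.
    by vring.
  by move=> y /Et; rewrite ET; exact: xmin.
have tq : N (q - x) = max_dist N x [fset p; q; r]%fset.
  have ET := esym (fset3_rot r p q).
  have Et y : in_triangle r p q y -> in_triangle p q r y.
    move=> [a [b [c [a0 b0 c0 abc ->]]]]; exists b, c, a; split=> //.
      by rewrite -abc; ring.
    by vring.
  rewrite -ET; apply: (@minimizer_touches r p q) => //.
    have [a [b [c [a0 b0 c0 abc ->]]]] := xin; exists c, a, b; split=> //.
      by rewrite -abc; ring.
    by vring.
  by move=> y /Et; rewrite ET; exact: xmin.
have epq : N (p - x) = N (q - x) by rewrite tp tq.
have eqr : N (q - x) = N (r - x) by rewrite tq tr.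
have erp : N (r - x) = N (p - x) by rewrite tr tp.
exists x; split=> //.
have dpq := acute_circumcenter_off_edge ar (acute_at_neq ap) epq eqr.
have dqr := acute_circumcenter_off_edge ap (acute_at_neq aq) eqr erp.
have drp := acute_circumcenter_off_edge aq (acute_at_neq ar) erp epq.
split=> //; have [a [b [c [a0 b0 c0 abc Ex]]]] := xin.
have E : a *: (p - x) + b *: (q - x) + c *: (r - x) = 0.
  have -> : a *: (p - x) + b *: (q - x) + c *: (r - x)
    = (a *: p + b *: q + c *: r) - (a + b + c) *: x by vring.
  by rewrite -Ex abc scale1r subrr.
exists a, b, c; split=> //; rewrite lt_neqAle ?a0 ?b0 ?c0 andbT eq_sym.
- apply/eqP => z.
  have [|l0 m0] := @det2_relation_trivial b c _ _ dqr; last by lra.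
  by rewrite -E z; vring.
- apply/eqP => z.
  have [|l0 m0] := @det2_relation_trivial c a _ _ drp; last by lra.
  by rewrite -E z; vring.
- apply/eqP => z.
  have [|l0 m0] := @det2_relation_trivial a b _ _ dpq; last by lra.
  by rewrite -E z; vring.
Qed.

Lemma circumcenter_unique p q r x y : surrounding_circumcenter p q r x ->
  N (p - y) = N (q - y) -> N (q - y) = N (r - y) -> y = x.
Proof.
move=> [sur epq eqr] dpq dqr.
have E z : z - y = z - x - (y - x) by vring.
rewrite !E in dpq dqr.
apply/eqP; rewrite -subr_eq0; apply/eqP.
exact: surrounding_circumcenter_unique sur epq eqr dpq dqr.
Qed.

(** With [q] as origin, failure at both vertices means
    [N (2 c - a) <= N a] and [N (2 a - c) <= N c]. As [3 a] and [3 c] are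
    positive combinations of [2 a - c] and [2 c - a], all these norms agree and
    strict convexity gives [a = c]. *)
Lemma at_most_one_nonacute p q r :
  p <> r -> ~ acute_at N r p q -> acute_at N p q r.
Proof.
rewrite /acute_at => neq /negP; rewrite -leNgt => le_r; rewrite ltNge.
apply/negP => le_p; apply: neq.
pose a := p - q; pose c := r - q.
have Na : N (2 *: c - a) <= N a.
  have -> : 2 *: c - a = 2 *: (r - 2^-1 *: (p + q)) by rewrite /a /c; vfield.
  by rewrite normZ_ge0 //; rewrite /a; lra.
have Nc : N (2 *: a - c) <= N c.
  have -> : 2 *: a - c = 2 *: (p - 2^-1 *: (q + r)) by rewrite /a /c; vfield.
  by rewrite normZ_ge0 // /c (norm_subC r); lra.
have Ea : 3 *: a = 2 *: (2 *: a - c) + (2 *: c - a) by vring.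
have Ec : 3 *: c = 2 *: (2 *: c - a) + (2 *: a - c) by vring.
have le_a : 3 * N a <= 2 * N (2 *: a - c) + N (2 *: c - a).
  by rewrite -!normZ_ge0 // Ea normD.
have le_c : 3 * N c <= 2 * N (2 *: c - a) + N (2 *: a - c).
  by rewrite -!normZ_ge0 // Ec normD.
have Eac : N a = N c by lra.
have {}Na : N (2 *: c - a) = N a by lra.
have {}Nc : N (2 *: a - c) = N a by lra.
have E : N (2 *: c - a) *: (2 *: (2 *: a - c))
    = N (2 *: (2 *: a - c)) *: (2 *: c - a).
  by apply: strict_triangle; rewrite -Ea !normZ_ge0 // Na Nc; ring.
rewrite normZ_ge0 // Na Nc in E.
have [a0|an0] := eqVneq (N a) 0.
  have /eqP := norm_eq0_inv a0.
  have /eqP := norm_eq0_inv (etrans (esym Eac) a0).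
  by rewrite !subr_eq0 => /eqP -> /eqP.
have E0 : (6 * N a) *: (a - c) = 0.
  rewrite -[RHS](subrr (N a *: (2 *: (2 *: a - c)))) {2}E; vring.
apply/eqP; rewrite -subr_eq0; apply/eqP.
have -> : p - r = a - c by rewrite /a /c; vring.
by apply: scale_eq0 E0 _; rewrite mulf_neq0 // pnatr_eq0.
Qed.

(** * Minimal enclosing disks *)

(** Minimality as a least upper bound property, without the infimum in
    [enclosing_radius]; it also asserts that the infimum is attained. *)
Definition minimal_disk P x (m : R) : Prop :=
  (forall p, p \in P -> N (x - p) <= m) /\
  (forall y (m' : R), (forall p, p \in P -> N (y - p) <= m') -> m <= m').

Lemma enclosing_radius_minimal P p x (m : R) :
  p \in P -> minimal_disk P x m -> enclosing_radius N P = m.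
Proof.
move=> pP [enc opt].
have m0 : 0 <= m by apply: le_trans (enc p pP); exact: norm_ge0.
have lb : lbound [set max_dist N z P | z in setT] m.
  by move=> _ [z _ <-]; apply: opt => q qP; exact: le_max_dist.
have mem : [set max_dist N z P | z in setT] m.
  exists x => //; apply/eqP; rewrite eq_le max_dist_le //=.
  by apply: opt => q qP; exact: le_max_dist.
apply/eqP; rewrite eq_le /enclosing_radius; apply/andP; split.
  by apply: ge_inf => //; exists m.
by apply: lb_le_inf => //; exists m.
Qed.

Lemma minimal_disk_superset P T x (m : R) : {subset T <= P} ->
  minimal_disk T x m -> (forall p, p \in P -> N (x - p) <= m) ->
  minimal_disk P x m.
Proof.
move=> sub [_ opt] enc; split=> // y m' encP.
by apply: (opt y) => p /sub; exact: encP.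
Qed.

Lemma minimal_disk_pair p q :
  minimal_disk [fset p; q]%fset (2^-1 *: (p + q)) (2^-1 * N (p - q)).
Proof.
split=> [z|y m enc].
  rewrite !inE => /orP[] /eqP ->.
    have -> : 2^-1 *: (p + q) - p = 2^-1 *: (q - p) by vfield.
    by rewrite normZ_ge0 ?invr_ge0 // norm_subC.
  have -> : 2^-1 *: (p + q) - q = 2^-1 *: (p - q) by vfield.
  by rewrite normZ_ge0 ?invr_ge0.
have Np := enc p (fset21 _ _); have Nq := enc q (fset22 _ _).
by have := norm_dist_triangle y p q; rewrite (norm_subC p y); lra.
Qed.

Lemma minimal_disk_nonacute p q r : ~ acute_at N r p q ->
  minimal_disk [fset p; q; r]%fset (2^-1 *: (p + q)) (2^-1 * N (p - q)).
Proof.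
move/negP; rewrite -leNgt => le_r.
apply: (minimal_disk_superset _ (minimal_disk_pair p q)) => z; rewrite !inE.
  by move=> ->.
case/orP; last by move=> /eqP ->; rewrite norm_subC mulrC.
by have [enc _] := minimal_disk_pair p q; move=> zpq; apply: enc; rewrite !inE.
Qed.

(** A disk of smaller radius with center [y] would satisfy the hypotheses of
    [surrounded_center_optimal], so [y] would be the circumcenter. *)
Lemma minimal_disk_circumcenter p q r x :
  surrounding_circumcenter p q r x ->
  minimal_disk [fset p; q; r]%fset x (N (x - p)).
Proof.
move=> [sur epq eqr].
split=> [z|y m enc].
  by rewrite !inE (norm_subC x z) (norm_subC x p) => /orP[/orP[]|] /eqP ->;
    rewrite ?epq ?eqr.
rewrite leNgt; apply/negP => lt_m.
have Nz z : z \in [fset p; q; r]%fset -> N (z - x) = N (x - p).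
  by rewrite !inE (norm_subC x p) => /orP[/orP[]|] /eqP ->; rewrite ?epq ?eqr.
have mem3 u : u \in [:: p - x; q - x; r - x] ->
    exists2 z, z \in [fset p; q; r]%fset & u = z - x.
  rewrite !inE => /or3P[] /eqP ->.
  - by exists p; rewrite ?inE ?eqxx.
  - by exists q; rewrite ?inE ?eqxx ?orbT.
  - by exists r; rewrite ?inE ?eqxx ?orbT.
have m0 : 0 <= m by apply: le_trans (enc p _); rewrite ?norm_ge0 ?inE ?eqxx.
have : y - x = 0.
  apply: (@surrounded_center_optimal (N (x - p)) _ _ _ _ sur); first by lra.
    by move=> u /mem3[z zT ->]; rewrite Nz.
  move=> u /mem3[z zT ->].
  have -> : z - x - (y - x) = z - y by vring.
  by rewrite norm_subC; apply: le_trans (enc z zT) (ltW lt_m).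
move=> /eqP; rewrite subr_eq0 => /eqP yx.
have := enc p; rewrite yx !inE eqxx => /(_ isT); lra.
Qed.

(** Either some vertex lies in the disk whose diameter is the opposite edge, or
    the triangle is norm-acute. *)
Lemma minimal_disk_triple p q r : p <> q -> q <> r -> r <> p ->
  exists x m, minimal_disk [fset p; q; r]%fset x m.
Proof.
move=> npq nqr nrp.
have [ar|nar] := pselect (acute_at N r p q); last first.
  by do 2 eexists; exact: minimal_disk_nonacute nar.
have [ap|nap] := pselect (acute_at N p q r); last first.
  rewrite -fset3_rot.
  by do 2 eexists; exact: minimal_disk_nonacute nap.
have [aq|naq] := pselect (acute_at N q r p); last first.
  rewrite -2!fset3_rot.
  by do 2 eexists; exact: minimal_disk_nonacute naq.
have [|x sx] := @acute_surrounding_circumcenter p q r; first by split.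
by do 2 eexists; exact: minimal_disk_circumcenter sx.
Qed.


Lemma card_fset3 p q r :
  #|` [fset p; q; r]%fset| = 3%N <-> [/\ p <> q, q <> r & r <> p].
Proof.
rewrite fsetUC cardfsU1 cardfs2 !inE; split.
  case: (r =P p) => nrp; case: (r =P q) => nrq; case: (p =P q) => npq //= _.
  by split=> //; exact: nesym.
move=> [/eqP npq /eqP nqr /eqP nrp].
by rewrite npq (negPf nrp) eq_sym (negPf nqr).
Qed.

(** A disk of radius [N (p - q) / 2] contains [p] and [q] only if its center is
    their midpoint. *)
Lemma radius_lt_third p q r : p <> q ->
    2^-1 * N (p - q) < N (2^-1 *: (p + q) - r) ->
  enclosing_radius N [fset p; q]%fset < enclosing_radius N [fset p; q; r]%fset.
Proof.
move=> npq out; have minpq := minimal_disk_pair p q.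
have nT v : v \in [fset p; q]%fset -> v <> r.
  by move=> vT E; have := minpq.1 v vT; rewrite E leNgt out.
have npr : p <> r by apply: nT; rewrite !inE eqxx.
have nqr : q <> r by apply: nT; rewrite !inE eqxx orbT.
have [y [m minT]] := minimal_disk_triple npq nqr (nesym npr).
rewrite (enclosing_radius_minimal (p := p) _ minpq) ?inE ?eqxx //.
rewrite (enclosing_radius_minimal (p := p) _ minT) ?inE ?eqxx //.
have [enc _] := minT; have [_ opt] := minpq.
have le_m : 2^-1 * N (p - q) <= m.
  by apply: (opt y) => z zpq; apply: enc; rewrite inE zpq.
rewrite ltNge; apply/negP => ge_m.
have yE : y = 2^-1 *: (p + q).
  apply: (@between_midpoint m); last by lra.
    by rewrite norm_subC enc // !inE eqxx.
  by rewrite norm_subC enc // !inE eqxx orbT.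
by have := enc r; rewrite !inE eqxx orbT yE => /(_ isT); lra.
Qed.

(** * The exchange step *)

Lemma surrounding_circumcenter_rot p q r x :
  surrounding_circumcenter p q r x -> surrounding_circumcenter q r p x.
Proof.
by move=> [/surrounds_origin_rot sur epq eqr]; split=> //; rewrite -eqr.
Qed.

Lemma surrounding_circumcenter_focus p q r x v :
    surrounding_circumcenter p q r x -> v \in [fset p; q; r]%fset ->
  exists q' r', surrounding_circumcenter v q' r' x /\
    [fset v; q'; r']%fset = [fset p; q; r]%fset.
Proof.
move=> sx; rewrite !inE => /orP[/orP[]|] /eqP ->.
- by exists q, r.
- exists r, p; split; first exact: surrounding_circumcenter_rot.
  exact: fset3_rot.
- exists p, q; split; last by rewrite -fset3_rot.
  exact/surrounding_circumcenter_rot/surrounding_circumcenter_rot.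
Qed.

Lemma surrounding_circumcenter_distinct p q r x :
  surrounding_circumcenter p q r x -> [/\ p <> q, q <> r & r <> p].
Proof.
have det_neq u v z : det2 (u - z) (v - z) != 0 -> u <> v.
  by move=> /det2_neq0[neq _] E; apply: neq; rewrite E.
move=> [sur _ _]; have sur2 := surrounds_origin_rot sur.
have sur3 := surrounds_origin_rot sur2.
by split; apply: (@det_neq _ _ x); [case: sur|case: sur2|case: sur3].
Qed.

Lemma fset3D1 p q r : p <> q -> r <> p ->
  ([fset p; q; r] `\ p)%fset = [fset q; r]%fset.
Proof.
move=> /eqP npq /eqP nrp; apply/fsetP => z; rewrite !inE.
have [->|] //= := eqVneq z p.
by rewrite (negPf npq) eq_sym (negPf nrp).
Qed.

Lemma sideE p x z : side p x z = - det2 (p - x) (z - x).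
Proof. by rewrite /side /det2 !mxE; ring. Qed.

Lemma det2_line p x z : p <> x -> det2 (p - x) (z - x) = 0 -> line p x z.
Proof.
move=> npx d; have [||k E] := det2_eq0_parallel (u := z - x) (v := p - x).
- by rewrite det2C d oppr0.
- by move=> /eqP; rewrite subr_eq0 => /eqP.
- by exists k; rewrite -[LHS](subrK x) E; vring.
Qed.

Lemma line_side p x z : line p x z -> side p x z = 0.
Proof. by move=> [t ->]; rewrite /side !mxE; ring. Qed.

(** The positive relation between the three vertices, seen from [x], puts [q]
    and [r] strictly on different sides of the line through [p] and [x]. *)
Lemma opposite_vertex_unique p q r x p4 :
    surrounding_circumcenter p q r x -> ~ line p x p4 ->
  exists p6, [set` ([fset p; q; r] `\ p)%fset] `&` opposite_half_plane p x p4
    = [set p6].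
Proof.
move=> sx off; have [npq nqr nrp] := surrounding_circumcenter_distinct sx.
rewrite fset3D1 //.
have [sur epq eqr] := sx.
have npx : p <> x.
  have [/det2_neq0[neq _] _] := sur; move=> E; apply: neq.
  have := epq; rewrite E subrr norm0 => /esym /norm_eq0_inv ->.
  by [].
have S0 : side p x p4 != 0.
  by rewrite sideE oppr_eq0; apply/eqP => /(det2_line npx).
have Sq : side p x q != 0 by rewrite sideE oppr_eq0; case: sur.
have [_ [a [b [c [a0 b0 c0 E]]]]] := sur.
have Sqr : b * side p x q = - (c * side p x r).
  have : det2 (p - x) (a *: (p - x) + b *: (q - x) + c *: (r - x)) = 0.
    by rewrite E /det2 !mxE; ring.
  rewrite -[X in det2 _ (X + _)]scale1r !det2_linear_r det2uu !sideE.
  lra.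
set S := side p x p4 in S0 *; set s := side p x q in Sq Sqr *.
have opp : S * s * b = - (S * side p x r * c).
  by rewrite -mulrA (mulrC s) Sqr; ring.
have [le0|gt0] := leP (S * s) 0.
  exists q; apply/seteqP; split=> z; last first.
    by move=> ->; split=> //=; rewrite !inE eqxx.
  move=> [/=]; rewrite !inE => /orP[/eqP //|/eqP ->].
  rewrite /opposite_half_plane /= -/S => le0'; have : S * s * b < 0.
    by rewrite pmulr_llt0 // lt_neqAle le0 mulf_neq0.
  have : S * side p x r * c <= 0 by rewrite pmulr_lle0.
  by rewrite -(oppr_ge0 (_ * c)) -opp => /le_lt_trans/[apply]; rewrite ltxx.
exists r; apply/seteqP; split=> z; last first.
  move=> ->; split=> /=; first by rewrite !inE eqxx orbT.
  rewrite /opposite_half_plane /= -/S -(pmulr_lle0 _ c0).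
  by apply: ltW; rewrite -oppr_gt0 -opp mulr_gt0.
move=> [/=]; rewrite !inE => /orP[/eqP ->|/eqP //].
by rewrite /opposite_half_plane /= -/S -/s leNgt gt0.
Qed.

(** With [x] as origin, let [u], [v], [w] stand for [p5], [p6], [p4], and
    [w = a u + b v]. The half plane condition says [b <= 0] and the choice of
    [p5] as a farthest vertex excludes [a >= 0]. If [b = 0], then [p4] and [p5]
    are opposite as seen from [x] and more than twice the old radius apart;
    otherwise the new triangle surrounds [x]. The case of [p4] on the line
    through [p5] and [x] is included: its side is 0. *)
Lemma exchange_radius_lt p1 p2 p3 x p4 p5 p6 :
    surrounding_circumcenter p1 p2 p3 x -> N (x - p1) < N (x - p4) ->
    p5 \in [fset p1; p2; p3]%fset ->
    N (p4 - p5) = max_dist N p4 [fset p1; p2; p3]%fset ->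
    p6 \in [fset p1; p2; p3]%fset -> p6 <> p5 ->
    side p5 x p4 * side p5 x p6 <= 0 ->
  [/\ p4 <> p5, p5 <> p6, p6 <> p4 &
   enclosing_radius N [fset p1; p2; p3]%fset
     < enclosing_radius N [fset p4; p5; p6]%fset].
Proof.
set T := [fset p1; p2; p3]%fset => sx out p5T far p6T n65 opp.
have minT := minimal_disk_circumcenter sx; set lam := N (x - p1) in out minT.
have NT z : z \in T -> N (z - x) = lam.
  have [_ e12 e23] := sx.
  by rewrite /lam (norm_subC x) !inE => /orP[/orP[]|] /eqP ->;
    rewrite -?e23 -?e12.
have n4 z : z \in T -> z <> p4.
  by move=> zT E; have := NT z zT; rewrite E norm_subC; lra.
have [n54 n64] := (n4 _ p5T, n4 _ p6T).
split; [exact: nesym|exact: nesym|by []|].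
rewrite (enclosing_radius_minimal p5T minT).
have [y [m min']] := minimal_disk_triple (nesym n54) (nesym n65) n64.
rewrite (enclosing_radius_minimal (p := p5) _ min') ?inE ?eqxx ?orbT //.
rewrite ltNge; apply/negP => m_le.
have enc z : z \in [fset p4; p5; p6]%fset -> N (z - y) <= lam.
  by move=> /min'.1; rewrite norm_subC => /le_trans; apply.
have [d0 [epq lam0]] : det2 (p5 - x) (p6 - x) != 0 /\
    N (p5 - x) = N (p6 - x) /\ 0 < lam.
  have [q' [r' [sx' ET]]] := surrounding_circumcenter_focus sx p5T.
  have d : det2 (p5 - x) (p6 - x) != 0.
    move: p6T; rewrite /T -ET !inE => /orP[/orP[]|] /eqP E6 //; rewrite E6.
      by case: sx' => -[].
    case: sx' => /surrounds_origin_rot/surrounds_origin_rot[d _] _ _.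
    by rewrite det2C oppr_eq0.
  have e56 : N (p5 - x) = N (p6 - x) by rewrite !NT.
  split=> //; split=> //; rewrite -(NT _ p5T).
  exact: distinct_norm_gt0 e56 (det2_neq0 d).1.
set u := p5 - x in d0 epq *; set v := p6 - x in d0 epq *.
pose w := p4 - x; have Nw : lam < N w by rewrite /w norm_subC.
have Nu : N u = lam by rewrite NT.
have := cramer_div w d0; set a := _ / _; set b := _ / _ => Ew.
have b_le0 : b <= 0.
  move: opp; rewrite !sideE -/u -/v -/w mulrNN /b => le0.
  (* The product of the two sides is b * det2 u v ^+ 2. *)
  rewrite -(@pmulr_lle0 _ (det2 u v ^+ 2)); last by rewrite exprn_even_gt0.
  by rewrite expr2 mulrA mulfVK.
have [a_ge0|a_lt0] := leP 0 a.
  have ab0 : 0 < a + - b.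
    rewrite lt_neqAle eq_sym addr_ge0 ?oppr_ge0 // andbT; apply/eqP => z.
    have az : a = 0 by lra.
    have bz : b = 0 by lra.
    by move: Nw; rewrite Ew az bz !scale0r addr0 norm0; lra.
  have mb : 0 <= - b by rewrite oppr_ge0.
  have := closer_in_cone epq (det2_neq0 d0).1 a_ge0 mb ab0.
  rewrite scaleNr opprK -Ew.
  have -> : w - u = p4 - p5 by rewrite /w /u; vring.
  have -> : w - v = p4 - p6 by rewrite /w /v; vring.
  by rewrite far ltNge le_max_dist.
have yx_enc z : z \in [fset p4; p5; p6]%fset -> N (z - x - (y - x)) <= lam.
  by move=> /enc; have -> : z - x - (y - x) = z - y by vring.
have [b0|bn0] := eqVneq b 0.
  have Nw' : N w = - a * lam.
    by rewrite {1}Ew b0 scale0r addr0 normZ ltr0_norm // Nu.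
  have N45 : N (p4 - p5) = (1 - a) * lam.
    have -> : p4 - p5 = (a - 1) *: u.
      have -> : p4 - p5 = w - u by rewrite /w /u; vring.
      by rewrite {1}Ew b0; vring.
    by rewrite normZ ltr0_norm ?Nu; [ring|lra].
  have : N (p4 - p5) <= N (p4 - y) + N (p5 - y).
    by rewrite (norm_subC p5 y); exact: norm_dist_triangle.
  have := enc p4; have := enc p5.
  rewrite !inE !eqxx !orbT => /(_ isT) + /(_ isT).
  rewrite N45; nra.
have sur : surrounds_origin u v w.
  split=> //; exists (- a), (- b), 1; split=> //; rewrite ?oppr_gt0 //.
    by rewrite lt_neqAle bn0.
  by rewrite {1}Ew; vring.
have yx : y - x = 0.
  apply: (@surrounded_center_optimal lam _ _ _ _ sur lam0).
    move=> z; rewrite !inE => /or3P[] /eqP ->; rewrite ?Nu -?epq ?Nu //.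
    exact: ltW.
  move=> z; rewrite !inE => /or3P[] /eqP ->; apply: yx_enc;
    by rewrite !inE eqxx ?orbT.
have := enc p4; rewrite !inE eqxx => /(_ isT).
have -> : p4 - y = w - (y - x) by rewrite /w; vring.
by rewrite yx subr0; lra.
Qed.

(** * Classification of triangles *)

Lemma acute3_rearrange p q r a b c : acute3 p q r ->
  a <> b -> b <> c -> c <> a -> [fset a; b; c]%fset = [fset p; q; r]%fset ->
  acute3 a b c.
Proof.
move=> [ar ap aq] nab nbc nca ET.
have [ar' ap' aq'] := And3 (acute_atC ar) (acute_atC ap) (acute_atC aq).
have mem z : z \in [fset a; b; c]%fset -> [\/ z = p, z = q | z = r].
  rewrite ET !inE => /orP[/orP[]|] /eqP ->.
  - exact: Or31.
  - exact: Or32.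
  - exact: Or33.
have := mem c; have := mem b; have := mem a; rewrite !inE !eqxx !orbT.
move=> /(_ isT) Ea /(_ isT) Eb /(_ isT) Ec.
by move: Ea Eb Ec nab nbc nca => [] -> [] -> [] -> //; split.
Qed.

(** By [at_most_one_nonacute] the other two vertices are norm-acute. *)
Lemma nonacute_vertex p q r :
    p <> q -> q <> r -> r <> p -> ~ acute_at N r p q ->
  norm_obtuse N [fset p; q; r]%fset r \/ norm_right N [fset p; q; r]%fset r.
Proof.
move=> npq nqr nrp nar.
have ap := at_most_one_nonacute (nesym nrp) nar.
have aq : acute_at N q r p.
  by apply: acute_atC; apply: at_most_one_nonacute => // /acute_atC.
have triT : triangle_on [fset p; q; r]%fset p q r.
  by split=> //; apply/card_fset3.
have : N (r - 2^-1 *: (p + q)) <= N (p - q) / 2.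
  by rewrite leNgt; apply/negP.
rewrite le_eqVlt => /orP[/eqP|] e.
  by right; exists p, q.
by left; exists p, q.
Qed.

Lemma dropped_vertex T v : norm_obtuse N T v \/ norm_right N T v ->
  exists a b, [/\ [/\ a <> b, b <> v & v <> a], T = [fset a; b; v]%fset,
    (T `\ v)%fset = [fset a; b]%fset & ~ acute_at N v a b].
Proof.
move=> obt; have [a [b [[card_T ET] nacute]]] : exists a b,
    triangle_on T a b v /\ ~ acute_at N v a b.
  case: obt => -[a [b [tri e _ _]]]; exists a, b; split=> //.
    by move: e; rewrite /obtuse_at /acute_at => /ltW; rewrite leNgt => /negP.
  by rewrite /acute_at e ltxx.
subst T; exists a, b; have /card_fset3[nab nbv nva] := card_T; split=> //.
by rewrite -2!fset3_rot fset3D1 //; exact: nesym.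
Qed.

Lemma acute3_no_drop p q r v : acute3 p q r ->
  ~ (norm_obtuse N [fset p; q; r]%fset v \/ norm_right N [fset p; q; r]%fset v).
Proof.
move=> ac /dropped_vertex[a [b [[nab nbv nva] ET _]]].
by apply; have [] := acute3_rearrange ac nab nbv nva (esym ET).
Qed.

Lemma norm_acuteP p q r : p <> q -> q <> r -> r <> p ->
  norm_acute N [fset p; q; r]%fset <-> acute3 p q r.
Proof.
move=> npq nqr nrp; split=> [[a [b [c [[cT ET] ac aa ab]]]]|[ar ap aq]].
  have ac3 : acute3 a b c by split.
  exact: acute3_rearrange ac3 npq nqr nrp ET.
exists p, q, r; split=> //; split=> //; exact/card_fset3.
Qed.

Lemma surrounding_circumcenter_bis p q r x :
  surrounding_circumcenter p q r x -> bis N p q `&` bis N q r = [set x].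
Proof.
move=> sx; have [_ epq eqr] := sx; apply/seteqP; split=> [z [zpq zqr]|_ ->].
  by apply: (circumcenter_unique sx); rewrite ?(norm_subC _ z).
by split; rewrite /bis /= !(norm_subC x).
Qed.

(** * Invariants and termination of the algorithm *)

Variable P : {fset 'rV[R]_2}.

(** The radius itself is real; counting the subsets of [P] with a larger radius
    turns its growth into the descent of a natural number. *)
Definition rank T : nat :=
  #|` [fset S in fpowerset P |
         enclosing_radius N T < enclosing_radius N S]%fset|.

Lemma rank_lt T S : (S `<=` P)%fset ->
  enclosing_radius N T < enclosing_radius N S -> (rank S < rank T)%N.
Proof.
move=> SP lt_TS; apply: fproper_ltn_card; rewrite fproperE; apply/andP; split.
  by apply/fsubsetP => A; rewrite !inE /= => /andP[-> /(lt_trans lt_TS)].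
apply/fsubsetPn; exists S; rewrite !inE /= fpowersetE SP //=.
by rewrite ltxx.
Qed.

Definition max_rank : nat := #|` fpowerset P|.

Lemma rank_le T : (rank T <= max_rank)%N.
Proof.
by apply: fsubset_leq_card; apply/fsubsetP => A; rewrite !inE => /andP[].
Qed.

(** From step 4 on, [x] is known to be interior to the triangle: this is what
    makes the vertex [p6] in step 5 unique and the exchange increase the
    radius. *)
Definition eh_invariant (s : eh_state R) : Prop :=
  match s with
  | AtStep1 => True
  | AtStep2 p q => ([fset p; q] `<=` P)%fset /\ p <> q
  | AtStep3 p q r | AtStep6 p q r =>
      ([fset p; q; r] `<=` P)%fset /\ #|` [fset p; q; r]%fset| = 3%N
  | AtStep4 p q r x lam => [/\ ([fset p; q; r] `<=` P)%fset,
      surrounding_circumcenter p q r x & lam = N (x - p)]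
  | AtStep5 p q r x p4 p5 => ([fset p; q; r] `<=` P)%fset /\
      [/\ surrounding_circumcenter p q r x, p4 \in P, N (x - p) < N (x - p4),
        p5 \in [fset p; q; r]%fset &
        N (p4 - p5) = max_dist N p4 [fset p; q; r]%fset]
  | Returned x lam => minimal_disk P x lam
  end.

(** Lexicographic in the rank and the position in the loop. The factor 6 exceeds
    the largest offset, so a drop of the rank outweighs any change of the
    position; the offsets decrease along the steps 6, 3, 4, 5 and 3, 2 that
    keep the radius. *)
Definition eh_measure (s : eh_state R) : nat :=
  match s with
  | AtStep1 => 6 * max_rank + 6
  | AtStep2 p q => 6 * rank [fset p; q]%fset + 1
  | AtStep3 p q r => 6 * rank [fset p; q; r]%fset + 4
  | AtStep4 p q r _ _ => 6 * rank [fset p; q; r]%fset + 3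
  | AtStep5 p q r _ _ _ => 6 * rank [fset p; q; r]%fset + 2
  | AtStep6 p q r => 6 * rank [fset p; q; r]%fset + 5
  | Returned _ _ => 0
  end.

Lemma fset2_sub p q : p \in P -> q \in P -> ([fset p; q] `<=` P)%fset.
Proof.
by move=> pP qP; apply/fsubsetP => z; rewrite !inE => /orP[] /eqP ->.
Qed.

Lemma fset3_sub p q r : p \in P -> q \in P -> r \in P ->
  ([fset p; q; r] `<=` P)%fset.
Proof.
by move=> pP qP rP; apply/fsubsetP => z; rewrite !inE => /orP[/orP[]|] /eqP ->.
Qed.

(** The rank drops exactly when a point outside the current disk is added,
    in leaving step 2 for step 3 or step 5 for step 6. *)
Lemma eh_step_invariant s t : eh_step N P s t -> eh_invariant s ->
  eh_invariant t /\ (eh_measure t < eh_measure s)%N.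
Proof.
case=> {s t}.
- move=> p q pP qP /eqP npq _; split=> /=.
    by split=> //; exact: fset2_sub.
  by have := rank_le [fset p; q]%fset; lia.
- move=> p q x lam enc [/fsubsetP sub npq]; split=> /=; last by lia.
  exact: minimal_disk_superset sub (minimal_disk_pair p q) enc.
- move=> p q r x lam rP out [sub npq].
  have lt_r := radius_lt_third npq out.
  have [pP qP] : p \in P /\ q \in P.
    by split; apply: (fsubsetP sub); rewrite !inE eqxx ?orbT.
  have T_P := fset3_sub pP qP rP; have := rank_lt T_P lt_r.
  split=> /=; last by lia.
  split=> //; apply/card_fset3; split=> // E.
    by move: out; rewrite -E ltNge (minimal_disk_pair p q).1 // !inE eqxx orbT.
  by move: out; rewrite E ltNge (minimal_disk_pair p q).1 // !inE eqxx.
- move=> p q r v q1 q2 T obt E [sub _].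
  have [a [b [[nab nbv nva] ET ED nacute]]] := dropped_vertex obt.
  have Eab : [fset q1; q2]%fset = [fset a; b]%fset by rewrite E.
  have Er : rank [fset q1; q2]%fset = rank [fset p; q; r]%fset.
    rewrite /rank Eab -/T ET.
    have min2 := minimal_disk_pair a b.
    have min3 := minimal_disk_nonacute nacute.
    rewrite (enclosing_radius_minimal (p := a) _ min2) ?inE ?eqxx //.
    by rewrite (enclosing_radius_minimal (p := a) _ min3) ?inE ?eqxx.
  split=> /=; last by rewrite Er; lia.
  split; first by rewrite E; apply: fsubset_trans sub; exact: fsubsetDl.
  have := cardfs2 q1 q2; rewrite Eab cardfs2; move/eqP: (nab) => ->.
  by case: eqP.
- move=> p q r x T _ ac bisE [sub card_T]; split=> /=; last by lia.
  split=> //; have [npq nqr nrp] := (card_fset3 p q r).1 card_T.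
  have ac3 := (norm_acuteP npq nqr nrp).1 ac.
  have [x' sx'] := acute_surrounding_circumcenter ac3.
  suff <- : x' = x by [].
  have : [set x'] x' by []; rewrite -(surrounding_circumcenter_bis sx') bisE.
  by [].
- move=> p q r x lam enc [/fsubsetP sub sx El]; split=> /=; last by lia.
  subst lam.
  exact: minimal_disk_superset sub (minimal_disk_circumcenter sx) enc.
- move=> p q r x lam p4 p5 T p4P out p5T far [sub sx El].
  split=> /=; last by lia.
  by split=> //; split=> //; rewrite -El.
- move=> p q r x p4 p5 p6 T _ E [sub [sx p4P out p5T far]].
  have : [set p6] p6 by [].
  rewrite -E => -[/=]; rewrite in_fsetD1 => /andP[/eqP n65 p6T] opp.
  have [n45 n56 n64 lt_r] := exchange_radius_lt sx out p5T far p6T n65 opp.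
  have T_P : ([fset p4; p5; p6] `<=` P)%fset.
    by apply: fset3_sub => //; exact: (fsubsetP sub).
  have := rank_lt T_P lt_r; split=> /=; last by lia.
  by split=> //; apply/card_fset3.
- move=> p q r x p4 p5 p6 T on p6T' [sub [sx p4P out p5T far]].
  move: p6T'; rewrite in_fsetD1 => /andP[/eqP n65 p6T].
  have opp : side p5 x p4 * side p5 x p6 <= 0 by rewrite (line_side on) mul0r.
  have [n45 n56 n64 lt_r] := exchange_radius_lt sx out p5T far p6T n65 opp.
  have T_P : ([fset p4; p5; p6] `<=` P)%fset.
    by apply: fset3_sub => //; exact: (fsubsetP sub).
  have := rank_lt T_P lt_r; split=> /=; last by lia.
  by split=> //; apply/card_fset3.
- move=> p4 p5 p6 q1 q2 q3 E [sub card_T] /=.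
  by rewrite E; split=> //; lia.
Qed.

Lemma fset3_max p q r z : exists2 v, v \in [fset p; q; r]%fset &
  N (z - v) = max_dist N z [fset p; q; r]%fset.
Proof.
set T := [fset p; q; r]%fset; apply: contrapT => none.
have lt_all v : v \in T -> N (z - v) < max_dist N z T.
  move=> vT; rewrite lt_neqAle le_max_dist // andbT; apply/eqP => E.
  by apply: none; exists v.
have pT : p \in T by rewrite !inE eqxx.
have := max_dist_lt (le_lt_trans (norm_ge0 _) (lt_all p pT)) lt_all.
by rewrite ltxx.
Qed.

Lemma eh_progress s : (2 <= #|` P|)%N -> eh_invariant s ->
  (exists t, eh_step N P s t) \/ (exists x lam, s = Returned x lam).
Proof.
move=> hP.
have outside x (lam : R) : (forall p, p \in P -> N (x - p) <= lam) \/
    (exists2 p, p \in P & lam < N (x - p)).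
  have [|no] := pselect (exists2 p, p \in P & lam < N (x - p)); [by right|left].
  by move=> p pP; rewrite leNgt; apply/negP => out; apply: no; exists p.
case: s => [|p q|p q r|p q r x lam|p q r x p4 p5|p q r|x lam] inv; last first.
- by right; exists x, lam.
- left; exists (AtStep3 p q r); exact: eh_new_triple.
- left; have [sub [sx p4P out p5T far]] := inv.
  have [q' [r' [sx' ET]]] := surrounding_circumcenter_focus sx p5T.
  have [npq nqr nrp] := surrounding_circumcenter_distinct sx'.
  have [on|off] := pselect (line p5 x p4).
    exists (AtStep6 p4 p5 q'); apply: eh_any_vertex => //.
    by rewrite -ET fset3D1 // !inE eqxx.
  have [p6 E] := opposite_vertex_unique sx' off.
  exists (AtStep6 p4 p5 p6); apply: eh_opposite_vertex => //.
  by rewrite -ET.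
- left; have [enc|[p4 p4P out]] := outside x lam.
    by exists (Returned x lam); apply: eh_return_triple.
  have [p5 p5T far] := fset3_max p q r p4.
  by exists (AtStep5 p q r x p4 p5); apply: eh_choose_fourth p4P out p5T far.
- left; have [sub card_T] := inv.
  have [npq nqr nrp] := (card_fset3 p q r).1 card_T.
  have drop v : norm_obtuse N [fset p; q; r]%fset v \/
      norm_right N [fset p; q; r]%fset v ->
      exists t, eh_step N P (AtStep3 p q r) t.
    move=> obt; have [a [b [_ _ ED _]]] := dropped_vertex obt.
    by exists (AtStep2 a b); exact: eh_drop_vertex obt (esym ED).
  have [ar|nar] := pselect (acute_at N r p q); last first.
    exact: drop (nonacute_vertex npq nqr nrp nar).
  have [ap|nap] := pselect (acute_at N p q r); last first.
    apply: (drop p); rewrite -fset3_rot.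
    exact: nonacute_vertex nqr nrp npq nap.
  have [aq|naq] := pselect (acute_at N q r p); last first.
    apply: (drop q); rewrite -2!fset3_rot.
    exact: nonacute_vertex nrp npq nqr naq.
  have ac : acute3 p q r by split.
  have [x sx] := acute_surrounding_circumcenter ac.
  exists (AtStep4 p q r x (N (x - p))); apply: eh_circumcenter.
  + by move=> v; exact: acute3_no_drop.
  + exact/norm_acuteP.
  + exact: surrounding_circumcenter_bis.
- left; have [enc|[r rP out]] := outside (2^-1 *: (p + q)) (2^-1 * N (p - q)).
    by eexists; apply: eh_return_pair enc.
  by exists (AtStep3 p q r); apply: eh_choose_third.
- left; have [p pP] : exists p, p \in P.
    by apply/fset0Pn; rewrite -cardfs_gt0; apply: leq_trans hP.
  have [q] : exists q, q \in (P `\ p)%fset.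
    apply/fset0Pn; rewrite -cardfs_gt0.
    by have := cardfsD1 p P; rewrite pP; lia.
  rewrite !inE => /andP[nqp qP].
  by exists (AtStep2 p q); apply: eh_choose_pair => //; rewrite eq_sym.
Qed.

Lemma eh_reachable_invariant s : eh_reachable N P s -> eh_invariant s.
Proof.
rewrite /eh_reachable => reach.
suff : eh_invariant AtStep1 -> eh_invariant s by apply.
elim: reach => [s1 s2 st inv|//|s1 s2 s3 _ IH1 _ IH2 inv].
  by have [] := eh_step_invariant st inv.
exact/IH2/IH1.
Qed.

End ElzingaHearn.

Theorem theorem3p2 (R : realType) (N : 'rV[R]_2 -> R)
    (hN : is_norm N) (hsc : strictly_convex N)
    (P : {fset 'rV[R]_2}) (hP : (2 <= #|` P|)%N) :
  (forall run : nat -> eh_state R, run 0%N = AtStep1 ->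
     ~ (forall n : nat, eh_step N P (run n) (run n.+1)))
  /\
  (forall s : eh_state R, eh_reachable N P s ->
     (forall t : eh_state R, ~ eh_step N P s t) ->
     exists (x : 'rV[R]_2) (lam : R),
       s = Returned x lam /\ is_minimal_enclosing_disk N P x lam).
Proof.
split=> [run run0 steps|s reach stuck].
  have decreasing n : eh_invariant N P (run n) /\
      (eh_measure N P (run n) + n <= eh_measure N P (run 0%N))%N.
    elim: n => [|n [inv le_n]]; first by rewrite run0 addn0.
    by have [] := eh_step_invariant hN hsc (steps n) inv; split=> //; lia.
  have [_] := decreasing (eh_measure N P (run 0%N)).+1; lia.
have inv := eh_reachable_invariant hN hsc reach.
have [[t st]|[x [lam Es]]] := eh_progress hN hsc hP inv.
  by case: (stuck t).
subst s; exists x, lam; split=> //; have [enc _] := inv.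
have [p pP] : exists p, p \in P.
  by apply/fset0Pn; rewrite -cardfs_gt0; apply: leq_trans hP.
split; first by rewrite (enclosing_radius_minimal hN pP inv).
by move=> q /enc; rewrite /disk /= (norm_subC hN).
Qed.
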